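(* Let $C=(C_n,\partial)$ be a chain complex in an abelian category (of modules over some ring) with an ascending $m$-step filtration $(F_pC)_{p\in\mathbb{Z}}$ by subcomplexes. Let $\iota:H(C)\to C$ be the natural generalized embedding of the total homology and, for each $p$, let $\iota_p:E^\infty_p\to C$ be the total embedding of the stable term $E^\infty_p$ of the spectral sequence associated to the filtration. Then, in every total degree, $\iota$ divides (lifts) $\iota_p$ for all $p$, and the quotients $\epsilon_p:=\iota_p/\iota:E^\infty_p\to H(C)$ are generalized embeddings which form an ascending $m$-filtration system of $H(C)$ that computes the induced filtration on $H(C)$, i.e. $\operatorname{Img}\epsilon_p=F_pH(C)$ for all $p$.
   Context: **Generalized morphisms.** A generalized morphism $\psi:S\to T$ is a pair $(\bar\psi,\imath)$, where $\imath:F\to T$ is a morphism (the morphism aid) and $\bar\psi:S\to T/\operatorname{im}\imath$ is a morphism (the associated morphism). Two generalized morphisms with the same $\operatorname{im}\imath$ and the same $\bar\psi$ are identified, so one writes $\psi=(\bar\psi,L_\psi)$ with $L_\psi=\operatorname{im}\imath\le T$. Ordinary morphisms are the generalized morphisms with $L_\psi=0$. Let $\pi:T\to T/L_\psi$ be the natural epimorphism. Set $\ker\psi:=\ker\bar\psi$, and define the combined image $\operatorname{Img}\psi:=\pi^{-1}(\operatorname{im}\bar\psi)\le T$. $\psi$ is a generalized embedding (monomorphism), resp. generalized isomorphism, if $\bar\psi$ is a monomorphism, resp. isomorphism. **Coarsening.** For $L_\psi\le L\le T$, the coarsening of $\psi$ to $L$ is $\widetilde\psi=(\bar\psi,L)$,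 where $\bar\psi$ now denotes the composition of $\bar\psi$ with $T/L_\psi\to T/L$. It is called effective if $\operatorname{Img}\psi\cap L=L_\psi$. **Lifting and quotient.** Let $\gamma=(\bar\gamma,L_\gamma):M'\to N$ and $\beta=(\bar\beta,L_\beta):N'\to N$ be generalized morphisms, let $L:=L_\gamma+L_\beta$, and let $\widetilde\gamma,\widetilde\beta$ be their coarsenings to $L$. One says $\beta$ lifts (or divides) $\gamma$ if (im) $\operatorname{Img}\widetilde\gamma\le\operatorname{Img}\widetilde\beta$, and (eff) $\operatorname{Img}\gamma\cap L=L_\gamma$. In that case the quotient $\gamma/\beta=\beta^{-1}\circ\gamma:M'\to N'$ is the generalized morphism $\alpha=(\bar\alpha,L_\alpha)$ where $L_\alpha$ is the preimage of $L/L_\beta$ under $\bar\beta:N'\to N/L_\beta$, and $\bar\alpha:M'\to N'/L_\alpha$ is the unique morphism whose composition with the monomorphism $N'/L_\alpha\to N/L$ induced by $\bar\beta$ equals the morphism $M'\to N/L$ associated to $\widetilde\gamma$. **Filtration systems.** Let $p_0,\dots,p_{m-1}$ be consecutive integers. An ascending $m$-filtration system of an object $M$ is a sequence of generalized embeddings $\psi_{p}=(\bar\psi_p,L_p)$, $p\in\{p_0,\dots,p_{m-1}\}$, with common target $M$ such that $L_{p_0}=0$, $L_p=\operatorname{Img}\psi_{p-1}$ for $p=p_1,\dots,p_{m-1}$, and $\operatorname{Img}\psi_{p_{m-1}}=M$. It computes a filtration $(F_pM)$ if $\operatorname{Img}\psi_p=F_pM$ for all $p$ in the index interval. **Filtered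 complexes.** An ascending filtration of $C$ is a chain of subcomplexes $F_{p-1}C\le F_pC$, exhaustive, Hausdorff and of finite length. It is an $m$-step filtration if there are consecutive integers $p_0,\dots,p_{m-1}$ with $F_{p_0-1}C=0$ and $F_{p_{m-1}}C=C$; these integers index the filtration system. The induced filtration on homology is $F_pH_n(C):=\operatorname{im}(H_n(F_pC)\to H_n(C))$. Total and complementary degrees are suppressed; every statement is read in each total degree $n$ (with target $C_n$). **Spectral sequence.** For $r\ge0$ put $A^r_p:=\{c\in F_pC\mid \partial c\in F_{p-r}C\}$, i.e. the kernel of the morphism $F_pC\to C/F_{p-r}C$ induced by $\partial$, with the same formula for $A^{-1}_{p}$. Put $Z^r_p:=A^r_p+F_{p-1}C$, $B^r_p:=\partial A^{r-1}_{p+(r-1)}+F_{p-1}C$, and $E^r_p:=Z^r_p/B^r_p$. Put $Z^\infty_p:=\bigcap_rZ^r_p$, $B^\infty_p:=\bigcup_rB^r_p$ and $E^\infty_p:=Z^\infty_p/B^\infty_p$ (all of these stabilize because the filtration is finite). **The embeddings.** The total embedding $\iota_p:E^\infty_p\to C$ is the generalized embedding with aid subobject $B^\infty_p$ and associated morphism the inclusion $Z^\infty_p/B^\infty_p\hookrightarrow C/B^\infty_p$. The generalized embedding $\iota:H(C)\to C$ has aid subobject $\operatorname{im}\partial$ and associated morphism the inclusion $\ker\partial/\operatorname{im}\partial\hookrightarrow C/\operatorname{im}\partial$. *)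

(* Defs.v *)
From HB Require Import structures.
From mathcomp Require Import all_boot all_order all_algebra.
From mathcomp Require Import generic_quotient ring_quotient boolp.

Local Obligation Tactic := idtac.

Set Implicit Arguments.
Unset Strict Implicit.
Unset Printing Implicit Defensive.

Import Order.TTheory GRing.Theory Num.Theory.
Local Open Scope ring_scope.
Local Open Scope quotient_scope.

(* Submodules are MathComp's [submodClosed] predicates.  They are boolean, so *)
(* membership in images, sums, unions and intersections is [asbool] of the    *)
(* defining proposition.                                                      *)

Section Submodules.
Variable R : pzRingType.
Implicit Types U V W : lmodType R.

Lemma asbool_subsemimod V (P : V -> Prop) (P0 : P 0)
    (PL : forall (a : R) x y, P x -> P y -> P (a *: x + y)) :
  GRing.subsemimod_closed (fun x : V => `[< P x >]).
Proof.
apply: GRing.submod_closed_semi; split; first exact/asboolP.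
by move=> a x y /asboolP Px /asboolP Py; apply/asboolP/PL.
Qed.

Definition submod_of V (P : V -> Prop) (P0 : P 0)
    (PL : forall (a : R) x y, P x -> P y -> P (a *: x + y)) : submodClosed V :=
  HB.pack_for (submodClosed V) (fun x : V => `[< P x >])
    (GRing.isSubmodClosed.Build R V (fun x : V => `[< P x >])
       (asbool_subsemimod P0 PL)).

Lemma submod_ofP V (P : V -> Prop) P0 PL x :
  reflect (P x) (x \in @submod_of V P P0 PL).
Proof. exact: (asboolP (P x)). Qed.

Lemma submodL V (S : submodClosed V) (a : R) x y :
  x \in S -> y \in S -> a *: x + y \in S.
Proof. by move=> xS yS; rewrite rpredD ?rpredZ. Qed.

Program Definition sub0 V : submodClosed V := @submod_of V (fun x => x = 0) _ _.
Next Obligation. by []. Qed.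
Next Obligation. by move=> V a x y /= -> ->; rewrite scaler0 addr0. Qed.

Program Definition subT V : submodClosed V := @submod_of V (fun=> True) _ _.
Next Obligation. by []. Qed.
Next Obligation. by []. Qed.

Program Definition subI V (S T : submodClosed V) : submodClosed V :=
  @submod_of V (fun x => x \in S /\ x \in T) _ _.
Next Obligation. by move=> V S T /=; rewrite !rpred0. Qed.
Next Obligation. by move=> V S T a x y /= [xS xT] [yS yT]; rewrite !submodL. Qed.

Program Definition subD V (S T : submodClosed V) : submodClosed V :=
  @submod_of V (fun x => exists s t, [/\ s \in S, t \in T & x = s + t]) _ _.
Next Obligation. by move=> V S T /=; exists 0, 0; rewrite !rpred0 addr0. Qed.
Next Obligation.
move=> V S T a x y /= [s [t [sS tT ->]]] [s' [t' [sS' tT' ->]]].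
by exists (a *: s + s'), (a *: t + t'); rewrite !submodL // scalerDr addrACA.
Qed.

Program Definition im_of U V (f : {linear U -> V}) (S : submodClosed U) :
  submodClosed V := @submod_of V (fun y => exists2 x, x \in S & y = f x) _ _.
Next Obligation. by move=> U V f S /=; exists 0; rewrite ?rpred0 ?linear0. Qed.
Next Obligation.
move=> U V f S a x y /= [s sS ->] [t tS ->].
by exists (a *: s + t); rewrite ?submodL // linearP.
Qed.

Definition im U V (f : {linear U -> V}) : submodClosed V := im_of f (subT U).

Program Definition preim_of U V (f : {linear U -> V}) (T : submodClosed V) :
  submodClosed U := @submod_of U (fun x => f x \in T) _ _.
Next Obligation. by move=> U V f T /=; rewrite linear0 rpred0. Qed.
Next Obligation. by move=> U V f T a x y /= xT yT; rewrite linearP submodL. Qed.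

Definition ker U V (f : {linear U -> V}) : submodClosed U := preim_of f (sub0 V).

Program Definition bigI V (S : nat -> submodClosed V) : submodClosed V :=
  @submod_of V (fun x => forall r, x \in S r) _ _.
Next Obligation. by move=> V S r /=; rewrite rpred0. Qed.
Next Obligation. by move=> V S a x y /= xS yS r; rewrite submodL. Qed.

Lemma chain_leq V (S : nat -> submodClosed V) :
  (forall r, {subset S r <= S r.+1}) ->
  forall r s, (r <= s)%N -> {subset S r <= S s}.
Proof.
move=> Sh r s; elim: s => [|s IHs]; first by rewrite leqn0 => /eqP->.
rewrite leq_eqVlt => /predU1P[-> //|]; rewrite ltnS => /IHs le_rs x /le_rs.
exact: Sh.
Qed.

Program Definition chainU V (S : nat -> submodClosed V)
    (Sh : forall r, {subset S r <= S r.+1}) : submodClosed V :=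
  @submod_of V (fun x => exists r, x \in S r) _ _.
Next Obligation. by move=> V S Sh /=; exists 0; rewrite rpred0. Qed.
Next Obligation.
move=> V S Sh a x y /= [r xS] [s yS]; exists (maxn r s); apply: submodL.
  exact: (chain_leq Sh (leq_maxl r s)).
exact: (chain_leq Sh (leq_maxr r s)).
Qed.

End Submodules.

Record submod (R : pzRingType) (V : lmodType R) (S : submodClosed V) :=
  Submod { submod_val : V; submod_valP : submod_val \in S }.

Section SubmodInstances.
Variables (R : pzRingType) (V : lmodType R) (S : submodClosed V).
HB.instance Definition _ := [isSub of submod S for @submod_val R V S].
HB.instance Definition _ := [Choice of submod S by <:].
HB.instance Definition _ := [SubChoice_isSubLmodule of submod S by <:].
End SubmodInstances.

Definition submod_zmod (R : pzRingType) (V : lmodType R) (S : submodClosed V) :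
    zmodClosed V :=
  HB.pack_for (zmodClosed V) (fun x : V => x \in S)
    (GRing.isZmodClosed.Build V (fun x : V => x \in S)
       (GRing.submod_closedB (submodClosedP S))).

(* V / S is MathComp's additive quotient [Quotient.quot], with scaling added. *)
Definition quotmod (R : pzRingType) (V : lmodType R) (S : submodClosed V) :=
  Quotient.quot (submod_zmod S).

Section QuotmodInstances.
Variables (R : pzRingType) (V : lmodType R) (S : submodClosed V).
Notation Q := (quotmod S).
HB.instance Definition _ := GRing.Zmodule.on Q.
HB.instance Definition _ := Quotient.on Q.

Definition qpi (x : V) : Q := \pi_Q x.

Lemma qpi_eq x y : (qpi x == qpi y) = (x - y \in S).
Proof. by have := @Quotient.idealrBE _ (submod_zmod S) x y => /esym. Qed.

Lemma qpi_surj (u : Q) : {x : V | u = qpi x}.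
Proof. by exists (repr u); rewrite /qpi reprK. Qed.

Lemma qpiD x y : qpi (x + y) = qpi x + qpi y.
Proof. exact: (raddfD (\pi_(Quotient.quot (submod_zmod S)))). Qed.

Definition qscale (a : R) (u : Q) : Q := qpi (a *: repr u).

Lemma qscaleE a x : qscale a (qpi x) = qpi (a *: x).
Proof.
apply/eqP; rewrite qpi_eq -scalerBr rpredZ // -qpi_eq.
by rewrite /qpi reprK.
Qed.

Fact qscaleA a b (u : Q) : qscale a (qscale b u) = qscale (a * b) u.
Proof. by have [x ->] := qpi_surj u; rewrite !qscaleE scalerA. Qed.
Fact qscale1 : left_id 1 qscale.
Proof. by move=> u; have [x ->] := qpi_surj u; rewrite !qscaleE scale1r. Qed.
Fact qscaleDr : right_distributive qscale +%R.
Proof.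
move=> a u v; have [x ->] := qpi_surj u; have [y ->] := qpi_surj v.
by rewrite -qpiD !qscaleE scalerDr qpiD.
Qed.
Fact qscaleDl (u : Q) : {morph qscale^~ u : a b / a + b}.
Proof.
by move=> a b; have [x ->] := qpi_surj u; rewrite !qscaleE scalerDl qpiD.
Qed.
HB.instance Definition _ :=
  GRing.Zmodule_isLmodule.Build R Q qscaleA qscale1 qscaleDr qscaleDl.

Fact qpi_linear : linear qpi.
Proof. by move=> a x y; rewrite qpiD -qscaleE. Qed.
HB.instance Definition _ := GRing.isLinear.Build R V Q _ qpi qpi_linear.

Lemma qpi_eq0 x : (qpi x == 0) = (x \in S).
Proof. by rewrite -(linear0 qpi) qpi_eq subr0. Qed.
End QuotmodInstances.

Section LinearMaps.
Variable R : pzRingType.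
Implicit Types U V W : lmodType R.

Definition incl V (S : submodClosed V) : {linear submod S -> V} := val.

Section SubMap.
Variables (U V : lmodType R) (f : {linear U -> V}).
Variables (A : submodClosed U) (B : submodClosed V).
Hypothesis fAB : forall x, x \in A -> f x \in B.

Definition sub_map_fun (x : submod A) : submod B := Submod (fAB (submod_valP x)).
Fact sub_map_linear : linear sub_map_fun.
Proof. by move=> a x y; apply/val_inj; rewrite /= !linearP. Qed.
Definition sub_map : {linear submod A -> submod B} :=
  HB.pack_for {linear submod A -> submod B} sub_map_fun
    (GRing.isLinear.Build _ _ _ _ sub_map_fun sub_map_linear).
End SubMap.

Section QuotLift.
Variables (U W : lmodType R) (f : {linear U -> W}) (A : submodClosed U).
Hypothesis fA : forall x, x \in A -> f x = 0.

Definition quot_lift_fun (u : quotmod A) : W := f (repr u).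
Lemma quot_lift_funE x : quot_lift_fun (qpi A x) = f x.
Proof.
apply/eqP; rewrite -subr_eq0 -linearB; apply/eqP/fA.
by rewrite -qpi_eq /qpi reprK.
Qed.
Fact quot_lift_linear : linear quot_lift_fun.
Proof.
move=> a u v; have [x ->] := qpi_surj u; have [y ->] := qpi_surj v.
by rewrite -linearP !quot_lift_funE linearP.
Qed.
Definition quot_lift : {linear quotmod A -> W} :=
  HB.pack_for {linear quotmod A -> W} quot_lift_fun
    (GRing.isLinear.Build _ _ _ _ quot_lift_fun quot_lift_linear).
Lemma quot_liftE x : quot_lift (qpi A x) = f x.
Proof. exact: quot_lift_funE. Qed.
End QuotLift.

Section QuotMap.
Variables (U V : lmodType R) (f : {linear U -> V}).
Variables (A : submodClosed U) (B : submodClosed V).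
Hypothesis fAB : forall x, x \in A -> f x \in B.

Fact quot_map_subproof x : x \in A -> (qpi B \o f) x = 0.
Proof. by move=> /fAB fxB; apply/eqP; rewrite qpi_eq0. Qed.
Definition quot_map : {linear quotmod A -> quotmod B} :=
  quot_lift (f := qpi B \o f) quot_map_subproof.
Lemma quot_mapE x : quot_map (qpi A x) = qpi B (f x).
Proof. exact: quot_liftE. Qed.
End QuotMap.

Definition quot_proj V (A B : submodClosed V) (AB : {subset A <= B}) :
  {linear quotmod A -> quotmod B} := quot_map (f := idfun) AB.
Lemma quot_projE V (A B : submodClosed V) (AB : {subset A <= B}) x :
  quot_proj AB (qpi A x) = qpi B x.
Proof. exact: quot_mapE. Qed.

(* Z / B for B <= Z <= V: the quotient of the module Z by its submodule B *)
Definition subquo V (Z B : submodClosed V) : lmodType R :=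
  quotmod (preim_of (incl Z) B).

Fact subquo_incl_subproof V (Z B : submodClosed V) (x : submod Z) :
  x \in preim_of (incl Z) B -> incl Z x \in B.
Proof. by move/submod_ofP. Qed.
Definition subquo_incl V (Z B : submodClosed V) :
  {linear subquo Z B -> quotmod B} := quot_map (@subquo_incl_subproof V Z B).

End LinearMaps.

(* Generalized morphisms in normal form (associated morphism, aid subobject). *)
Record genmor (R : pzRingType) (S T : lmodType R) := GenMor {
  aid : submodClosed T;
  assoc : {linear S -> quotmod aid} }.

Section GeneralizedMorphisms.
Variable R : pzRingType.
Implicit Types M N S T V : lmodType R.

Definition Img S T (psi : genmor S T) : submodClosed T :=
  preim_of (qpi (aid psi)) (im (assoc psi)).

Definition gen_embedding S T (psi : genmor S T) : Prop :=
  injective (assoc psi).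

Definition coarsening S T (psi : genmor S T) (L : submodClosed T)
    (psiL : {subset aid psi <= L}) : genmor S T :=
  GenMor (quot_proj psiL \o assoc psi).

Lemma subDl V (A B : submodClosed V) : {subset A <= subD A B}.
Proof. by move=> x xA; apply/submod_ofP; exists x, 0; rewrite rpred0 addr0. Qed.
Lemma subDr V (A B : submodClosed V) : {subset B <= subD A B}.
Proof. by move=> x xB; apply/submod_ofP; exists 0, x; rewrite rpred0 add0r. Qed.

Section Lifting.
Variables (M' N' N : lmodType R) (gamma : genmor M' N) (beta : genmor N' N).

Definition common_aid : submodClosed N := subD (aid gamma) (aid beta).
Definition coarse_gamma : genmor M' N :=
  coarsening (@subDl N (aid gamma) (aid beta)).
Definition coarse_beta : genmor N' N :=
  coarsening (@subDr N (aid gamma) (aid beta)).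

(* beta lifts (divides) gamma *)
Record lifts : Prop := Lifts {
  lifts_im : {subset Img coarse_gamma <= Img coarse_beta};
  lifts_eff : subI (Img gamma) common_aid =i aid gamma }.

(* preimage under beta of L / L_beta, the latter being the image of L *)
Definition quotient_aid : submodClosed N' :=
  preim_of (assoc beta) (im_of (qpi (aid beta)) common_aid).

Lemma quotient_aidE y :
  (y \in quotient_aid) = (assoc coarse_beta y == 0).
Proof.
have [z yz] := qpi_surj (assoc beta y).
have -> : assoc coarse_beta y
          = quot_proj (@subDr N (aid gamma) (aid beta)) (assoc beta y) by [].
rewrite yz quot_projE qpi_eq0; apply/submod_ofP/idP; rewrite yz.
  case/submod_ofP=> x xL /eqP; rewrite qpi_eq => zx.
  by rewrite -(subrK x z) rpredD // subDr.
by move=> zL; apply/submod_ofP; exists z.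
Qed.

Fact quotient_mono_subproof y :
  y \in quotient_aid -> assoc coarse_beta y = 0.
Proof. by rewrite quotient_aidE => /eqP. Qed.

(* the monomorphism N' / L_alpha -> N / L induced by beta *)
Definition quotient_mono : {linear quotmod quotient_aid -> quotmod common_aid} :=
  quot_lift quotient_mono_subproof.

Lemma quotient_mono_inj : injective quotient_mono.
Proof.
move=> u v; have [x ->] := qpi_surj u; have [y ->] := qpi_surj v.
rewrite !quot_liftE => /eqP; rewrite -subr_eq0 -linearB -quotient_aidE.
by rewrite -qpi_eq => /eqP.
Qed.

Lemma quotient_exists : lifts ->
  exists alpha : {linear M' -> quotmod quotient_aid},
    forall x, quotient_mono (alpha x) = assoc coarse_gamma x.
Proof.
case=> im_le _.
have ex x : exists u, quotient_mono u = assoc coarse_gamma x.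
  have [z gz] := qpi_surj (assoc coarse_gamma x).
  have /im_le/submod_ofP/submod_ofP[y _ zy] : z \in Img coarse_gamma.
    by apply/submod_ofP/submod_ofP; exists x => //; apply/submod_ofP.
  by exists (qpi _ y); rewrite quot_liftE gz; symmetry.
pose f x := projT1 (cid (ex x)).
have fE x : quotient_mono (f x) = assoc coarse_gamma x.
  exact: (projT2 (cid (ex x))).
have f_lin : linear f.
  by move=> a x y; apply: quotient_mono_inj; rewrite linearP !fE linearP.
by exists (HB.pack_for {linear M' -> quotmod quotient_aid} f
  (GRing.isLinear.Build _ _ _ _ f f_lin)).
Qed.

Definition gen_quotient (h : lifts) : genmor M' N' :=
  GenMor (projT1 (cid (quotient_exists h))).

Lemma gen_quotientE (h : lifts) x :
  quotient_mono (assoc (gen_quotient h) x) = assoc coarse_gamma x.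
Proof. exact: (projT2 (cid (quotient_exists h))). Qed.

End Lifting.

(* The index interval {p_0, ..., p_(m-1)} is {p0, ..., p0 + m - 1}. *)
Definition in_steps (p0 : int) (m : nat) (p : int) : bool := p0 <= p < p0 + m%:Z.

Record filtration_system (p0 : int) (m : nat) M (S : int -> lmodType R)
    (psi : forall p, genmor (S p) M) : Prop := FiltrationSystem {
  fs_embedding : forall p, in_steps p0 m p -> gen_embedding (psi p);
  fs_first : aid (psi p0) =i sub0 M;
  fs_step : forall p, in_steps p0 m p -> p != p0 ->
    aid (psi p) =i Img (psi (p - 1));
  fs_last : Img (psi (p0 + m%:Z - 1)) =i subT M }.

Definition computes (p0 : int) (m : nat) M (S : int -> lmodType R)
    (psi : forall p, genmor (S p) M) (F : int -> submodClosed M) : Prop :=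
  forall p, in_steps p0 m p -> Img (psi p) =i F p.

End GeneralizedMorphisms.

(* Chain complexes indexed by int.  The differential is given for all pairs   *)
(* of degrees and vanishes unless the degree drops by one, which avoids       *)
(* transporting along n + 1 - 1 = n.                                          *)
Record chain_complex (R : pzRingType) := ChainComplex {
  chain :> int -> lmodType R;
  diff : forall i j, {linear chain i -> chain j};
  diff_shape : forall i j x, i != j + 1 -> diff i j x = 0;
  diff_diff : forall i j k x, diff j k (diff i j x) = 0 }.

Record chain_map (R : pzRingType) (C D : chain_complex R) := ChainMap {
  chain_fun :> forall n, {linear C n -> D n};
  chain_comm : forall i j x,
    chain_fun j (diff C i j x) = diff D i j (chain_fun i x) }.

Record subcomplex (R : pzRingType) (C : chain_complex R) := Subcomplex {
  subc :> forall n, submodClosed (C n);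
  subc_diff : forall i j x, x \in subc i -> diff C i j x \in subc j }.

Section Homology.
Variable R : pzRingType.
Implicit Types C D : chain_complex R.

Definition cycles C n : submodClosed (C n) := ker (diff C n (n - 1)).
Definition boundaries C n : submodClosed (C n) := im (diff C (n + 1) n).
Definition homology C n : lmodType R := subquo (cycles C n) (boundaries C n).

Section HomologyMap.
Variables (C D : chain_complex R) (f : chain_map C D) (n : int).

Fact cycles_map_subproof x : x \in cycles C n -> f n x \in cycles D n.
Proof.
move=> /submod_ofP/submod_ofP dx; apply/submod_ofP/submod_ofP.
by rewrite -chain_comm dx linear0.
Qed.
Definition cycles_map : {linear submod (cycles C n) -> submod (cycles D n)} :=
  sub_map cycles_map_subproof.

Fact homology_map_subproof x :
  x \in preim_of (incl (cycles C n)) (boundaries C n) ->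
  cycles_map x \in preim_of (incl (cycles D n)) (boundaries D n).
Proof.
move=> /submod_ofP/submod_ofP[y _ xy]; apply/submod_ofP/submod_ofP.
exists (f _ y); first exact/submod_ofP.
by rewrite -chain_comm -xy.
Qed.
Definition homology_map : {linear homology C n -> homology D n} :=
  quot_map homology_map_subproof.
End HomologyMap.

Section SubcomplexAsComplex.
Variables (C : chain_complex R) (F : subcomplex C).

Definition subc_chain n : lmodType R := submod (F n).
Definition subc_d i j : {linear subc_chain i -> subc_chain j} :=
  sub_map (@subc_diff R C F i j).
Fact subc_shape i j x : i != j + 1 -> subc_d i j x = 0.
Proof. by move=> ij; apply/val_inj; rewrite /= diff_shape. Qed.
Fact subc_dd i j k x : subc_d j k (subc_d i j x) = 0.
Proof. by apply/val_inj; rewrite /= diff_diff. Qed.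
Definition subc_complex : chain_complex R := ChainComplex subc_shape subc_dd.

Definition subc_incl : chain_map subc_complex C :=
  @ChainMap R subc_complex C (fun n => incl (F n)) (fun i j x => erefl).
End SubcomplexAsComplex.

Definition homology_embedding C n : genmor (homology C n) (C n) :=
  GenMor (subquo_incl (cycles C n) (boundaries C n)).

End Homology.

Record filtration (R : pzRingType) (C : chain_complex R) := Filtration {
  fil :> int -> subcomplex C;
  fil_chain : forall p n, {subset fil (p - 1) n <= fil p n};
  fil_exhaustive : forall n (x : C n), exists p, x \in fil p n;
  fil_hausdorff : forall n (x : C n), (forall p, x \in fil p n) -> x = 0;
  fil_finite : exists a b : int, forall n,
    (forall p, p <= a -> fil p n =i fil a n) /\
    (forall p, b <= p -> fil p n =i fil b n) }.

Definition m_step (R : pzRingType) (C : chain_complex R) (F : filtration C)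
    (p0 : int) (m : nat) : Prop :=
  forall n, F (p0 - 1) n =i sub0 (C n) /\ F (p0 + m%:Z - 1) n =i subT (C n).

Section SpectralSequence.
Variables (R : pzRingType) (C : chain_complex R) (F : filtration C).

(* n is the total degree; r is an integer because Bterm 0 uses r = -1. *)
Definition Aterm (r p n : int) : submodClosed (C n) :=
  subI (F p n) (preim_of (diff C n (n - 1)) (F (p - r) (n - 1))).

Definition Zterm (r : nat) (p n : int) : submodClosed (C n) :=
  subD (Aterm r%:Z p n) (F (p - 1) n).

Definition Bterm (r : nat) (p n : int) : submodClosed (C n) :=
  subD (im_of (diff C (n + 1) n) (Aterm (r%:Z - 1) (p + (r%:Z - 1)) (n + 1)))
       (F (p - 1) n).

Definition Eterm (r : nat) (p n : int) : lmodType R :=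
  subquo (Zterm r p n) (Bterm r p n).

Lemma Bterm_chain p n r : {subset Bterm r p n <= Bterm r.+1 p n}.
Proof.
move=> x /submod_ofP[y [z [/submod_ofP[w wA ->] zF ->]]].
apply/submod_ofP; exists (diff C (n + 1) n w), z; split=> //.
apply/submod_ofP; exists w => //.
have /submod_ofP[wF /submod_ofP dw] := wA.
have r1 : r.+1%:Z - 1 = r%:Z by rewrite intS addrC addKr.
apply/submod_ofP; split; rewrite r1.
  by apply: fil_chain; rewrite -addrA.
by apply/submod_ofP; move: dw; rewrite !addrK.
Qed.

Definition Zinf (p n : int) : submodClosed (C n) := bigI (fun r => Zterm r p n).
Definition Binf (p n : int) : submodClosed (C n) :=
  chainU (@Bterm_chain p n).
Definition Einf (p n : int) : lmodType R := subquo (Zinf p n) (Binf p n).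

Definition total_embedding (p n : int) : genmor (Einf p n) (C n) :=
  GenMor (subquo_incl (Zinf p n) (Binf p n)).

Definition homology_filtration (p n : int) : submodClosed (homology C n) :=
  im (homology_map (subc_incl (F p)) n).

End SpectralSequence.

(* Main.v *)
Require Import Defs.
From mathcomp Require Import all_boot all_order all_algebra.
From mathcomp Require Import zify.

(** Fix a degree, let Z and B be the cycles and boundaries of C there, and
    write F_p for the degree part of the filtration.  Since the filtration is
    finite, A^r_p becomes F_p /\ Z for r large, and B^r_p becomes
    (F_p /\ B) + F_(p-1), whence
      - Z^oo_p = (F_p /\ Z) + F_(p-1)   ([mem_Zinf]),
      - B^oo_p = (F_p /\ B) + F_(p-1)   ([mem_Binf]).
    The common aid of the two embeddings is therefore
      L = B^oo_p + B = F_(p-1) + B       ([common_aid_total_homology]).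
    Both lifting conditions can be read off: Z^oo_p is contained in Z + L, and
    if f + b lies in Z^oo_p, hence in F_p, with f in F_(p-1) and b in B, then
    b lies in F_p /\ B, so that Z^oo_p /\ L = B^oo_p.

    The quotient of two embeddings of subquotients Z1/B1 and Z2/B2 of one module
    has an explicit description: with L = B1 + B2, the class of z in Z2 lies in
    its aid iff z is in L, and in its combined image iff z is in Z1 + L
    ([mem_quotient_aid_subquo], [mem_Img_gen_quotient_subquo]).  Here F_pH(C)
    consists of the classes of the cycles in F_p + B
    ([mem_homology_filtration]).  The aid of eps_p is thus F_(p-1)H(C).  A cycle
    in Z^oo_p + L lies in F_p + B, and a cycle a + b with a in F_p and b in B
    has a in F_p /\ Z, hence in Z^oo_p; so Img eps_p = F_pH(C).  Consecutive
    terms of the system match because aid eps_p and Img eps_(p-1) are the same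
    submodule, and its two ends come from F_(p0-1) = 0 and
    F_(p0+m-1) = C.  Finally eps_p is an embedding because the effectiveness
    condition makes the coarsening of an embedding injective
    ([gen_quotient_embedding]). *)

Set Implicit Arguments.
Unset Strict Implicit.
Unset Printing Implicit Defensive.

Import Order.TTheory GRing.Theory Num.Theory.
Local Open Scope ring_scope.

(** * Membership in submodules *)

Section Membership.
Variable R : pzRingType.
Implicit Types U V : lmodType R.

Lemma subD_mem V (A B : submodClosed V) x y :
  x \in A -> y \in B -> x + y \in subD A B.
Proof. by move=> xA yB; apply/submod_ofP; exists x, y. Qed.

Lemma submodN V (S : submodClosed V) x : x \in S -> - x \in S.
Proof. by move=> xS; rewrite -scaleN1r rpredZ. Qed.

Lemma submodB V (S : submodClosed V) x y : x \in S -> y \in S -> x - y \in S.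
Proof. by move=> xS yS; rewrite rpredD ?submodN. Qed.

Lemma sub0P V (x : V) : reflect (x = 0) (x \in sub0 V).
Proof. by apply: (iffP idP) => [/submod_ofP|->]; rewrite ?rpred0. Qed.

Lemma mem_im U V (f : {linear U -> V}) x : f x \in im f.
Proof. by apply/submod_ofP; exists x => //; apply/submod_ofP. Qed.

Lemma imP U V (f : {linear U -> V}) y : reflect (exists x, y = f x) (y \in im f).
Proof.
apply: (iffP idP) => [/submod_ofP[x _ ->]|[x ->]]; first by exists x.
exact: mem_im.
Qed.

Lemma kerP U V (f : {linear U -> V}) x : reflect (f x = 0) (x \in ker f).
Proof.
by apply: (iffP idP) => [/submod_ofP/sub0P|/sub0P fx] //; apply/submod_ofP.
Qed.

End Membership.

(** * Quotients of generalized morphisms *)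

Section GeneralizedMorphisms.
Variable R : pzRingType.
Implicit Types M N S T V : lmodType R.

Lemma Img_qpi S T (psi : genmor S T) x :
  reflect (exists s, assoc psi s = qpi (aid psi) x) (x \in Img psi).
Proof.
apply: (iffP idP) => [/submod_ofP/imP[s ->]|[s sx]]; first by exists s.
by apply/submod_ofP; rewrite /= -sx mem_im.
Qed.

Lemma coarsening_qpi S T (psi : genmor S T) (L : submodClosed T)
    (psiL : {subset aid psi <= L}) s x :
  assoc psi s = qpi (aid psi) x -> assoc (coarsening psiL) s = qpi L x.
Proof.
move=> sx.
have -> : assoc (coarsening psiL) s = quot_proj psiL (assoc psi s) by [].
by rewrite sx quot_projE.
Qed.

(** The quotient is determined by its composition with the induced monomorphism
    N' / L_alpha -> N / L, so membership in its image can be tested in N / L,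
    where only the coarsenings of gamma and beta remain. *)
Lemma Img_gen_quotient M' N' N (gamma : genmor M' N) (beta : genmor N' N)
    (h : lifts gamma beta) y :
  reflect (exists x, assoc (coarse_gamma gamma beta) x
                     = assoc (coarse_beta gamma beta) y)
          (y \in Img (gen_quotient h)).
Proof.
apply: (iffP (Img_qpi _ _)) => -[x xy]; exists x.
  by rewrite -(gen_quotientE h) xy quot_liftE.
by apply: quotient_mono_inj; rewrite gen_quotientE xy quot_liftE.
Qed.

(** Two elements with the same image in N / L differ by an element whose image
    under gamma lies both in Img gamma and in L, hence in L_gamma by
    effectiveness; so the coarsening of gamma, through which the quotient is
    defined, loses no injectivity. *)
Lemma gen_quotient_embedding M' N' N (gamma : genmor M' N) (beta : genmor N' N)
    (h : lifts gamma beta) :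
  gen_embedding gamma -> gen_embedding (gen_quotient h).
Proof.
move=> gamma_inj x y /(congr1 (@quotient_mono _ _ _ _ gamma beta)).
rewrite !gen_quotientE => /eqP; rewrite -subr_eq0 -linearB => /eqP xy0.
apply/eqP; rewrite -subr_eq0; apply/eqP/gamma_inj; rewrite linear0.
have [z xyz] := qpi_surj (assoc gamma (x - y)).
move: xy0; rewrite (coarsening_qpi _ xyz) => /eqP; rewrite qpi_eq0 => zL.
apply/eqP; rewrite xyz qpi_eq0 -(lifts_eff h).
by apply/submod_ofP; split=> //; apply/Img_qpi; exists (x - y).
Qed.

(** * Quotients of embeddings of subquotients *)

(** The common form of [total_embedding] and [homology_embedding], which are
    both convertible to instances of it. *)
Definition subquo_embedding V (Z B : submodClosed V) : genmor (subquo Z B) V :=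
  GenMor (subquo_incl Z B).

Lemma assoc_subquoE V (Z B : submodClosed V) (z : submod Z) :
  assoc (subquo_embedding Z B) (qpi (preim_of (incl Z) B) z) = qpi B (val z).
Proof. exact: quot_mapE. Qed.

Lemma subquo_embeddingP V (Z B : submodClosed V) :
  gen_embedding (subquo_embedding Z B).
Proof.
move=> u v; have [x ->] := qpi_surj u; have [y ->] := qpi_surj v.
rewrite !assoc_subquoE => /eqP; rewrite qpi_eq => xyB.
by apply/eqP; rewrite qpi_eq; apply/submod_ofP; rewrite linearB.
Qed.

(** An explicit preimage takes the place of membership in the combined image of
    the coarsening, as both [Img_qpi] and [Img_gen_quotient] reduce to this
    form. *)
Lemma Img_coarsening_subquo V (Z B L : submodClosed V) (BL : {subset B <= L}) x :
  reflect (exists z, assoc (coarsening (psi := subquo_embedding Z B) BL) z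
                     = qpi L x)
          (x \in subD Z L).
Proof.
apply: (iffP idP) => [/submod_ofP[z [l [zZ lL ->]]]|[u]].
  exists (qpi _ (Submod zZ)); rewrite (coarsening_qpi _ (assoc_subquoE _ _)) /=.
  by apply/eqP; rewrite qpi_eq opprD addNKr submodN.
have [z ->] := qpi_surj u; rewrite (coarsening_qpi _ (assoc_subquoE _ _)) => /eqP.
rewrite qpi_eq => zxL; rewrite -(subKr (val z) x).
by rewrite subD_mem ?(valP z) ?submodN.
Qed.

Section SubquotientQuotient.
Variables (V : lmodType R) (Z1 B1 Z2 B2 : submodClosed V).
Let gamma := subquo_embedding Z1 B1.
Let beta := subquo_embedding Z2 B2.
Let L := subD B1 B2.

(** Since B1 <= Z1, the combined image of gamma is Z1, and the two conditions for
    lifting become statements about submodules of V. *)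
Lemma subquo_lifts : {subset B1 <= Z1} -> {subset Z1 <= subD Z2 L} ->
  (forall x, x \in Z1 -> x \in L -> x \in B1) -> lifts gamma beta.
Proof.
move=> BZ1 Z12 eff; split=> [x /Img_qpi/Img_coarsening_subquo|x].
  move=> /submod_ofP[z [l [/Z12 zZ2L lL ->]]].
  apply/Img_qpi/Img_coarsening_subquo; rewrite rpredD //.
  exact: subDr.
apply/submod_ofP/idP => [[/Img_qpi[u]]|xB1].
  have [z ->] := qpi_surj u; rewrite assoc_subquoE => /eqP.
  rewrite qpi_eq => zxB1; apply: eff.
  by rewrite -(subKr (val z) x) submodB ?(valP z) // BZ1.
split; last exact: subDl.
apply/Img_qpi; exists 0; rewrite linear0; apply/esym/eqP.
by rewrite qpi_eq0.
Qed.

Lemma mem_quotient_aid_subquo (z : submod Z2) :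
  (qpi (preim_of (incl Z2) B2) z \in quotient_aid gamma beta) = (val z \in L).
Proof.
by rewrite quotient_aidE (coarsening_qpi _ (assoc_subquoE _ _)) qpi_eq0.
Qed.

Lemma mem_Img_gen_quotient_subquo (h : lifts gamma beta) (z : submod Z2) :
  (qpi (preim_of (incl Z2) B2) z \in Img (gen_quotient h))
  = (val z \in subD Z1 L).
Proof.
have betaE : assoc (coarse_beta gamma beta) (qpi _ z) = qpi L (val z).
  exact/coarsening_qpi/assoc_subquoE.
have B1L : {subset B1 <= L} := @subDl _ _ B1 B2.
have coarseP := @Img_coarsening_subquo _ Z1 B1 L B1L (val z).
by apply/Img_gen_quotient/coarseP; rewrite betaE.
Qed.

End SubquotientQuotient.
End GeneralizedMorphisms.

(** * Limit terms and homology of a filtered complex *)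

Section FilteredComplex.
Variables (R : pzRingType) (C : chain_complex R) (F : filtration C).

Lemma fil_mono n p q : p <= q -> {subset F p n <= F q n}.
Proof.
move=> pq; have -> : q = p + `|q - p|%N%:Z by lia.
elim: `|q - p|%N => [|k IH] x; first by rewrite addr0.
by move/IH=> xF; apply: fil_chain; rewrite (_ : _ - 1 = p + k%:Z) //; lia.
Qed.

(** The finiteness axiom only makes the filtration constant far out; the
    Hausdorff and exhaustiveness axioms identify the constant values. *)
Lemma fil_bounds : exists a b : int,
  forall n, F a n =i sub0 (C n) /\ F b n =i subT (C n).
Proof.
have [a [b Fab]] := fil_finite F; exists a, b => n; have [Fa Fb] := Fab n.
split=> x; apply/idP/submod_ofP => //.
- move=> xa; apply: (fil_hausdorff (f := F)) => p; have [pa|/ltW ap] := leP p a.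
    by rewrite (Fa p pa).
  exact: fil_mono xa.
- by move=> ->; rewrite rpred0.
- have [p xp] := fil_exhaustive F x => _; have [pb|/ltW bp] := leP p b.
    exact: fil_mono xp.
  by rewrite -(Fb p bp).
Qed.

(** An element of Z^r_p with p - r so small that F_(p-r) = 0 has an honest cycle
    as its first summand; cycles in F_p in turn lie in every A^r_p. *)
Lemma mem_Zinf p n :
  Zinf F p n =i subD (subI (F p n) (cycles C n)) (F (p - 1) n).
Proof.
move=> x; apply/submod_ofP/submod_ofP => [xZ|].
  (* r = |p - a| ensures p - r <= a, where the filtration vanishes *)
  have [a [b Fab]] := fil_bounds.
  have /submod_ofP[z [f [/submod_ofP[zF /submod_ofP dz] fF ->]]] := xZ `|p - a|%N.
  exists z, f; split=> //; apply/submod_ofP; split=> //; apply/kerP.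
  have [Fa _] := Fab (n - 1); apply/sub0P.
  by rewrite -Fa; apply: fil_mono dz; lia.
move=> [a [f [/submod_ofP[aF /kerP da] fF ->]]] r.
apply: subD_mem => //; apply/submod_ofP; split=> //.
by apply/submod_ofP; rewrite da rpred0.
Qed.

(** A boundary lying in F_p is the boundary of an element of some
    F_(p+r-1), which is everything for r large. *)
Lemma mem_Binf p n :
  Binf F p n =i subD (subI (F p n) (boundaries C n)) (F (p - 1) n).
Proof.
move=> x; apply/submod_ofP/submod_ofP.
  move=> [r /submod_ofP[y [f [/submod_ofP[w wA ->] fF ->]]]].
  have /submod_ofP[_ /submod_ofP dw] := wA.
  exists (diff C (n + 1) n w), f; split=> //; apply/submod_ofP.
  by split; [move: dw; rewrite !addrK | exact: mem_im].
move=> [y [f [/submod_ofP[yF /imP[w yw]] fF ->]]].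
(* in B^r the chains range over F_(p + r - 1), so r - 1 = |p - b| suffices *)
have [a [b Fab]] := fil_bounds; exists `|p - b|.+1.
apply: subD_mem => //; apply/submod_ofP; exists w => //.
apply/submod_ofP; split; last first.
  by apply/submod_ofP; rewrite !addrK -yw.
have [_ Fb] := Fab (n + 1); apply: (@fil_mono _ b); first lia.
by rewrite Fb; apply/submod_ofP.
Qed.

Lemma boundaries_cycles n : {subset boundaries C n <= cycles C n}.
Proof. by move=> _ /imP[w ->]; apply/kerP; rewrite diff_diff. Qed.

(** The summand F_p /\ B of B^oo_p is absorbed by B. *)
Lemma common_aid_total_homology p n :
  subD (Binf F p n) (boundaries C n) =i subD (F (p - 1) n) (boundaries C n).
Proof.
move=> x; apply/submod_ofP/submod_ofP => -[y [b [yB bB ->]]].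
  move: yB; rewrite mem_Binf => /submod_ofP[b' [f [/submod_ofP[_ b'B] fF ->]]].
  by exists f, (b' + b); rewrite rpredD // addrCA addrA.
by exists y, b; rewrite mem_Binf subDr.
Qed.

Lemma total_lifts p n : lifts (total_embedding F p n) (homology_embedding C n).
Proof.
apply: subquo_lifts => [x|x|x].
- rewrite mem_Binf mem_Zinf => /submod_ofP[b [f [/submod_ofP[bF bB] fF ->]]].
  apply: subD_mem => //; apply/submod_ofP; split=> //.
  exact: boundaries_cycles.
- rewrite mem_Zinf => /submod_ofP[z [f [/submod_ofP[_ zZ] fF ->]]].
  by apply: subD_mem => //; rewrite common_aid_total_homology subDl.
rewrite mem_Zinf common_aid_total_homology mem_Binf.
move=> /submod_ofP[z [f [/submod_ofP[zF _] fF xE]]].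
move=> /submod_ofP[f' [b [f'F bB xE']]].
have p1 : p - 1 <= p by lia.
rewrite xE' addrC; apply: subD_mem => //; apply/submod_ofP; split=> //.
have -> : b = z + f - f' by rewrite -xE xE' addrAC subrr add0r.
by rewrite submodB ?rpredD // (fil_mono p1).
Qed.

(** Homologous cycles differ by an element of B, so having some representative
    in F_p can be tested on an arbitrary one once B is added to F_p. *)
Lemma mem_homology_filtration p n (z : submod (cycles C n)) :
  (qpi (preim_of (incl (cycles C n)) (boundaries C n)) z
     \in homology_filtration F p n)
  = (val z \in subD (F p n) (boundaries C n)).
Proof.
apply/imP/submod_ofP => [[u]|[a [b [aF bB zE]]]].
  have [w ->] := qpi_surj u; rewrite quot_mapE => /eqP.
  rewrite qpi_eq => /submod_ofP; rewrite linearB => zwB.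
  exists (val (val w)), (val z - val (val w)).
  by split; [exact: valP | exact: zwB | rewrite addrC subrK].
(* a differs from the cycle z by a boundary, so it is a cycle of F_p *)
have da : diff C n (n - 1) a = 0.
  have /kerP dz := valP z; have /kerP db := boundaries_cycles bB.
  by move: dz; rewrite zE linearD db addr0.
have aZ : (Submod aF : subc_complex (F p) n) \in cycles (subc_complex (F p)) n.
  by apply/kerP/val_inj.
exists (qpi _ (Submod aZ)); rewrite quot_mapE; apply/eqP; rewrite qpi_eq.
apply/submod_ofP; rewrite linearB /= /incl.
by rewrite [val z]zE /= addrAC subrr add0r.
Qed.

Lemma quotient_aid_total p n :
  quotient_aid (total_embedding F p n) (homology_embedding C n)
  =i homology_filtration F (p - 1) n.
Proof.
move=> u; have [z ->] := qpi_surj u.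
rewrite mem_homology_filtration -common_aid_total_homology.
exact: mem_quotient_aid_subquo.
Qed.

Lemma Img_total_quotient p n
    (h : lifts (total_embedding F p n) (homology_embedding C n)) :
  Img (gen_quotient h) =i homology_filtration F p n.
Proof.
move=> u; have [z ->] := qpi_surj u; rewrite mem_homology_filtration.
have p1 : p - 1 <= p by lia.
rewrite mem_Img_gen_quotient_subquo; apply/submod_ofP/submod_ofP.
  move=> [x [l []]]; rewrite mem_Zinf common_aid_total_homology.
  move=> /submod_ofP[a [f [/submod_ofP[aF _] fF ->]]].
  move=> /submod_ofP[f' [b [f'F bB ->]]] ->; exists (a + f + f'), b.
  by rewrite addrA !rpredD // (fil_mono p1).
move=> [a [b [aF bB zE]]]; exists a, b; split=> //; last exact: subDr.
rewrite mem_Zinf; apply: subDl; apply/submod_ofP; split=> //.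
by rewrite -(addrK b a) -zE submodB ?(valP z) ?boundaries_cycles.
Qed.

End FilteredComplex.

Theorem theorem5p1 (R : pzRingType) (C : chain_complex R) (F : filtration C)
    (p0 : int) (m : nat) (m_gt0 : (0 < m)%N) (Fm : m_step F p0 m) (n : int) :
  exists h : forall p : int, lifts (total_embedding F p n) (homology_embedding C n),
    let eps := fun p : int => gen_quotient (h p) in
    [/\ forall p : int, gen_embedding (eps p),
        filtration_system p0 m eps,
        computes p0 m eps (fun p => homology_filtration F p n)
      & forall p : int, Img (eps p) =i homology_filtration F p n].
Proof.
exists (fun p => total_lifts F p n) => eps.
have emb p : gen_embedding (eps p).
  exact/gen_quotient_embedding/subquo_embeddingP.
have ImgE p : Img (eps p) =i homology_filtration F p n.
  exact: Img_total_quotient.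
have aidE p : aid (eps p) =i homology_filtration F (p - 1) n.
  exact: quotient_aid_total.
have [F0 FT] := Fm n.
split=> [||p _|] //; split=> [p _||p _ _ u|u] //.
- move=> u; rewrite aidE; have [z ->] := qpi_surj u.
  rewrite mem_homology_filtration; apply/submod_ofP/submod_ofP.
    move=> [a [b []]]; rewrite F0 => /submod_ofP-> bB zE.
    rewrite add0r in zE; apply/eqP; rewrite qpi_eq0; apply/submod_ofP.
    by rewrite -zE in bB.
  move=> /eqP; rewrite qpi_eq0 => /submod_ofP zB.
  by exists 0, (val z); rewrite rpred0 add0r.
- by rewrite aidE ImgE.
- rewrite ImgE; have [z ->] := qpi_surj u; rewrite mem_homology_filtration.
  by apply/idP/submod_ofP => // _; apply: subDl; rewrite FT; apply/submod_ofP.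
Qed.
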